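(* Let $R$ be a commutative ring with a derivation $D_R$. If $BM(R)=1$ then $MBM^{\text{diff}}(R)=BM^{\text{diff}}(R)$.
   Context: A differential Azumaya $R$-algebra is an Azumaya $R$-algebra $A$ with a derivation $D_A$ extending $D_R$. Isomorphisms of differential algebras are $R$-algebra isomorphisms commuting with the derivations. The tensor product $A\otimes_R B$ of differential algebras has derivation $D_A\otimes 1+1\otimes D_B$. If $N\subseteq M$ is a submonoid of a commutative monoid, $M/N$ is the monoid of equivalence classes of $M$ under: $m_1\sim m_2$ iff there are $n_1,n_2\in N$ with $m_1n_1=m_2n_2$. If $P\subseteq Q\subseteq M$ are submonoids, $Q/P$ is regarded as a submonoid of $M/P$. For $Z\in M_n(R)$ ($n\ge1$), $(M_n(R),Z)$ denotes $M_n(R)$ with the derivation $Y\mapsto Y'+ZY-YZ$, where $Y'$ is the entrywise derivative. $MA(R)$ is the monoid (under $\otimes_R$) of isomorphism classes of Azumaya $R$-algebras, $MM(R)$ its submonoid of classes of matrix algebras $M_n(R)$, $n\ge1$, and $BM(R)=MA(R)/MM(R)$. $MA^{\text{diff}}(R)$ is the monoid (under $\otimes_R$) of differential isomorphism classes of differential Azumaya $R$-algebras; $MM^{\text{diff}}(R)$ is its submonoid of classes of algebras $(M_n(R),Z)$; $MM_0^{\text{diff}}(R)$ its submonoid of classes of algebras $(M_n(R),0)$. $BM^{\text{diff}}(R)=MA^{\text{diff}}(R)/MM_0^{\text{diff}}(R)$ and its submonoid $MBM^{\text{diff}}(R)=MM^{\text{diff}}(R)/MM_0^{\text{diff}}(R)$.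 *)

(* Defs.v *)
From HB Require Import structures.
From mathcomp Require Import all_boot all_algebra.
From mathcomp Require Import generic_quotient boolp.

Set Implicit Arguments.
Unset Strict Implicit.
Unset Printing Implicit Defensive.

Import GRing.Theory.
Local Open Scope ring_scope.
Local Open Scope quotient_scope.

(* An R-algebra is a ring A with a ring morphism from R to the center of A.
   (MathComp's algType R only contains nonzero algebras; here the zero ring and
   zero algebras are allowed.) *)
HB.mixin Record PzRing_isRAlg (R : comPzRingType) A of GRing.PzRing A := {
  in_ralg : R -> A;
  in_ralgD : {morph in_ralg : r s / r + s};
  in_ralg1 : in_ralg 1 = 1;
  in_ralgM : {morph in_ralg : r s / r * s};
  in_ralgC : forall r x, in_ralg r * x = x * in_ralg r
}.

#[short(type="ralgType")]
HB.structure Definition RAlg (R : comPzRingType) :=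
  {A of PzRing_isRAlg R A & GRing.PzRing A}.

Definition ascale (R : comPzRingType) (A : ralgType R) (r : R) (x : A) : A :=
  in_ralg r * x.
Notation "r *:: x" := (ascale r x) (at level 40) : ring_scope.

Section AscaleTheory.
Variables (R : comPzRingType) (A : ralgType R).
Implicit Types (r s : R) (x y : A).

Lemma ascaleDr r x y : r *:: (x + y) = r *:: x + r *:: y.
Proof. exact: mulrDr. Qed.
Lemma ascaleDl r s x : (r + s) *:: x = r *:: x + s *:: x.
Proof. by rewrite /ascale in_ralgD mulrDl. Qed.
Lemma ascaleA r s x : r *:: (s *:: x) = (r * s) *:: x.
Proof. by rewrite /ascale in_ralgM mulrA. Qed.
Lemma ascale1 x : 1 *:: x = x.
Proof. by rewrite /ascale in_ralg1 mul1r. Qed.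
Lemma ascaleAl r x y : r *:: (x * y) = (r *:: x) * y.
Proof. exact: mulrA. Qed.
Lemma ascaleAr r x y : r *:: (x * y) = x * (r *:: y).
Proof. by rewrite /ascale mulrA in_ralgC mulrA. Qed.
Lemma ascaler1 r : r *:: (1 : A) = in_ralg r.
Proof. exact: mulr1. Qed.
Lemma ascaler0 r : r *:: (0 : A) = 0.
Proof. exact: mulr0. Qed.
Lemma ascale_sumr r (I : Type) (s : seq I) (P : pred I) (F : I -> A) :
  r *:: (\sum_(i <- s | P i) F i) = \sum_(i <- s | P i) r *:: F i.
Proof. exact: mulr_sumr. Qed.
End AscaleTheory.

(* R-linear maps between algebras. *)
Definition alinear (R : comPzRingType) (A B : ralgType R) (f : A -> B) : Prop :=
  forall r x y, f (r *:: x + y) = r *:: f x + f y.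

Section LinearFacts.
Variables (R : comPzRingType) (A B : ralgType R) (f : A -> B).

Lemma alinearP :
  {morph f : x y / x + y} -> (forall r x, f (r *:: x) = r *:: f x) -> alinear f.
Proof. by move=> fD fZ r x y; rewrite fD fZ. Qed.

Hypothesis lf : alinear f.

Lemma linD : {morph f : x y / x + y}.
Proof. by move=> x y; have := lf 1 x y; rewrite !ascale1. Qed.

Lemma linZ r x : f (r *:: x) = r *:: f x.
Proof.
have f0 : f 0 = 0 by apply: (addIr (f 0)); rewrite -linD !add0r.
by have := lf r x 0; rewrite f0 !addr0.
Qed.
End LinearFacts.

Section MorphD.
Variables (G H : zmodType) (f : G -> H).
Hypothesis fD : {morph f : x y / x + y}.

Lemma morphD0 : f 0 = 0.
Proof. by apply: (addIr (f 0)); rewrite -fD !add0r. Qed.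

Lemma morphDN x : f (- x) = - f x.
Proof. by apply: (addIr (f x)); rewrite -fD !addNr morphD0. Qed.

Lemma morphD_sum (I : Type) (s : seq I) (P : pred I) (F : I -> G) :
  f (\sum_(i <- s | P i) F i) = \sum_(i <- s | P i) f (F i).
Proof. exact: (big_morph f fD morphD0). Qed.
End MorphD.

(* U (x)_R V: formal finite sums of pairs (u, v), written as sequences, modulo
   the congruence generated by the defining relations of the tensor product. *)
Section Tensor.
Variables (R : comPzRingType) (U V : ralgType R).

Inductive tens_rel : seq (U * V) -> seq (U * V) -> Prop :=
| TensRefl s : tens_rel s s
| TensSym s t : tens_rel s t -> tens_rel t s
| TensTrans s t w : tens_rel s t -> tens_rel t w -> tens_rel s w
| TensCat s s' t t' :
    tens_rel s s' -> tens_rel t t' -> tens_rel (s ++ t) (s' ++ t')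
| TensComm s t : tens_rel (s ++ t) (t ++ s)
| TensZero v : tens_rel [:: (0, v)] [::]
| TensDl u1 u2 v : tens_rel [:: (u1 + u2, v)] [:: (u1, v); (u2, v)]
| TensDr u v1 v2 : tens_rel [:: (u, v1 + v2)] [:: (u, v1); (u, v2)]
| TensBal r u v : tens_rel [:: (r *:: u, v)] [:: (u, r *:: v)].

Definition tens_relb s t := `[< tens_rel s t >].

Lemma tens_relb_refl : reflexive tens_relb.
Proof. by move=> s; apply/asboolP/TensRefl. Qed.

Lemma tens_relb_sym : symmetric tens_relb.
Proof. by move=> s t; apply/asboolP/asboolP; apply: TensSym. Qed.

Lemma tens_relb_trans : transitive tens_relb.
Proof.
by move=> t s w /asboolP h /asboolP h'; apply/asboolP; apply: TensTrans h h'.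
Qed.

Canonical tens_equiv :=
  EquivRel tens_relb tens_relb_refl tens_relb_sym tens_relb_trans.

Definition tensor : Type := {eq_quot tens_equiv}.
HB.instance Definition _ := Choice.on tensor.
HB.instance Definition _ := EqQuotient.on tensor.

Definition tens_of (s : seq (U * V)) : tensor := \pi_tensor s.

Lemma tens_ofP s t : tens_of s = tens_of t <-> tens_rel s t.
Proof.
split=> [/eqP|h].
  by rewrite eqmodE => /asboolP.
by apply/eqP; rewrite eqmodE; apply/asboolP.
Qed.

Lemma tens_of_repr x : tens_of (repr x) = x.
Proof. exact: reprK. Qed.

Lemma tens_ofW (P : tensor -> Prop) : (forall s, P (tens_of s)) -> forall x, P x.
Proof. by move=> h x; rewrite -(tens_of_repr x). Qed.

Definition tens (u : U) (v : V) : tensor := tens_of [:: (u, v)].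

Definition tens_zero : tensor := tens_of [::].
Definition tens_add (x y : tensor) : tensor := tens_of (repr x ++ repr y).
Definition tens_opp (x : tensor) : tensor :=
  tens_of [seq (- p.1, p.2) | p <- repr x].

Lemma tens_addE s t : tens_add (tens_of s) (tens_of t) = tens_of (s ++ t).
Proof. by apply/tens_ofP; apply: TensCat; apply/tens_ofP; rewrite tens_of_repr. Qed.

Lemma tens_addA : associative tens_add.
Proof.
elim/tens_ofW=> s; elim/tens_ofW=> t; elim/tens_ofW=> w.
by rewrite !tens_addE catA.
Qed.

Lemma tens_addC : commutative tens_add.
Proof.
elim/tens_ofW=> s; elim/tens_ofW=> t; rewrite !tens_addE.
exact/tens_ofP/TensComm.
Qed.

Lemma tens_add0 : left_id tens_zero tens_add.
Proof. by elim/tens_ofW=> s; rewrite tens_addE. Qed.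

Lemma tens_addN : left_inverse tens_zero tens_opp tens_add.
Proof.
move=> x; rewrite -{2}[x]tens_of_repr tens_addE; elim: (repr x) => //= [[u v] s].
set s' := map _ s => IHs; rewrite -[_ :: _ ++ _]cat1s -tens_addE -tens_addE.
rewrite -[(u, v) :: s]cat1s -[tens_of ([:: _] ++ s)]tens_addE.
rewrite [tens_add (tens_of s') _]tens_addC -tens_addA.
rewrite [tens_add (tens_of s) (tens_of s')]tens_addC tens_addE IHs.
rewrite [tens_add _ tens_zero]tens_addC tens_add0 tens_addE; apply/tens_ofP.
apply: TensTrans (TensZero v); apply: TensSym.
by have := TensDl (- u) u v; rewrite addNr.
Qed.

HB.instance Definition _ :=
  GRing.isZmodule.Build tensor tens_addA tens_addC tens_add0 tens_addN.

Lemma tens_of_cat s t : tens_of (s ++ t) = tens_of s + tens_of t.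
Proof. by rewrite -tens_addE. Qed.

Lemma tens_ofE s : tens_of s = \sum_(p <- s) tens p.1 p.2.
Proof.
elim: s => [|[u v] s IHs]; first by rewrite big_nil.
by rewrite big_cons -IHs -cat1s tens_of_cat.
Qed.

Lemma tensDl u1 u2 v : tens (u1 + u2) v = tens u1 v + tens u2 v.
Proof.
by rewrite -tens_of_cat; apply/tens_ofP; apply: TensDl.
Qed.

Lemma tensDr u v1 v2 : tens u (v1 + v2) = tens u v1 + tens u v2.
Proof. by rewrite -tens_of_cat; apply/tens_ofP; apply: TensDr. Qed.

Lemma tens_bal r u v : tens (r *:: u) v = tens u (r *:: v).
Proof. by apply/tens_ofP; apply: TensBal. Qed.

Lemma tens0l v : tens 0 v = 0.
Proof. by apply/tens_ofP; apply: TensZero. Qed.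

Lemma tens0r u : tens u 0 = 0.
Proof. exact: (morphD0 (tensDr u)). Qed.

Lemma tensP (P : tensor -> Prop) :
  (forall u v, P (tens u v)) -> (forall x y, P x -> P y -> P (x + y)) ->
  forall x, P x.
Proof.
move=> Pt PD; elim/tens_ofW=> s; rewrite tens_ofE; elim: s => [|p s IHs].
  by rewrite big_nil -(tens0l 0).
by rewrite big_cons; apply: PD.
Qed.

Section Lift.
Variables (G : zmodType) (f : U -> V -> G).

Definition balanced :=
  [/\ forall u1 u2 v, f (u1 + u2) v = f u1 v + f u2 v,
      forall u v1 v2, f u (v1 + v2) = f u v1 + f u v2
    & forall r u v, f (r *:: u) v = f u (r *:: v)].

(* The additive map U (x) V -> G induced by a balanced f. *)
Definition tens_lift (x : tensor) : G := \sum_(p <- repr x) f p.1 p.2.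

Hypothesis fb : balanced.

Lemma tens_lift_of s : tens_lift (tens_of s) = \sum_(p <- s) f p.1 p.2.
Proof.
have [fDl fDr fZ] := fb.
have f0 v : f 0 v = 0 by apply: (addIr (f 0 v)); rewrite -fDl !add0r.
suff H s1 s2 : tens_rel s1 s2 ->
    \sum_(p <- s1) f p.1 p.2 = \sum_(p <- s2) f p.1 p.2.
  by apply: H; apply/tens_ofP; rewrite tens_of_repr.
elim=> {s s1 s2} //=.
- by move=> s t w _ -> _ ->.
- by move=> s s' t t' _ IHs _ IHt; rewrite !big_cat /= IHs IHt.
- by move=> s t; rewrite !big_cat /= addrC.
- by move=> v; rewrite big_seq1 big_nil /= f0.
- by move=> u1 u2 v; rewrite !(big_cons, big_nil) /= !addr0 fDl.
- by move=> u v1 v2; rewrite !(big_cons, big_nil) /= !addr0 fDr.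
- by move=> r u v; rewrite !big_seq1 /= fZ.
Qed.

Lemma tens_liftE u v : tens_lift (tens u v) = f u v.
Proof. by rewrite tens_lift_of big_seq1. Qed.

Lemma tens_liftD : {morph tens_lift : x y / x + y}.
Proof.
elim/tens_ofW=> s; elim/tens_ofW=> t.
by rewrite -tens_of_cat !tens_lift_of big_cat.
Qed.
End Lift.

Lemma tens_lift_morphD (G H : zmodType) (f : U -> V -> G) (h : G -> H) :
  {morph h : x y / x + y} -> forall x,
  h (tens_lift f x) = tens_lift (fun u v => h (f u v)) x.
Proof. by move=> hD x; rewrite /tens_lift (morphD_sum hD). Qed.

Lemma tens_lift_add (G : zmodType) (f g : U -> V -> G) x :
  tens_lift (fun u v => f u v + g u v) x = tens_lift f x + tens_lift g x.
Proof. by rewrite /tens_lift big_split. Qed.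

Lemma eq_tens_lift (G : zmodType) (f g : U -> V -> G) :
  (forall u v, f u v = g u v) -> tens_lift f =1 tens_lift g.
Proof. by move=> fg x; apply: eq_bigr => p _. Qed.

Lemma tens_balanced : balanced tens.
Proof. by split; [apply: tensDl | apply: tensDr | apply: tens_bal]. Qed.

End Tensor.

Arguments tens {R U V} u v.
Arguments tens_lift {R U V G} f x.

Lemma tens_suml (R : comPzRingType) (U V : ralgType R) (I : Type) (s : seq I)
    (P : pred I) (F : I -> U) (v : V) :
  tens (\sum_(i <- s | P i) F i) v = \sum_(i <- s | P i) tens (F i) v.
Proof. by apply: (@morphD_sum _ _ (tens^~ v)) => x y; apply: tensDl. Qed.

Lemma tens_sumr (R : comPzRingType) (U V : ralgType R) (I : Type) (s : seq I)
    (P : pred I) (F : I -> V) (u : U) :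
  tens u (\sum_(i <- s | P i) F i) = \sum_(i <- s | P i) tens u (F i).
Proof. by apply: (@morphD_sum _ _ (tens u)) => x y; apply: tensDr. Qed.

Section TensorAlgebra.
Variables (R : comPzRingType) (A B : ralgType R).
Implicit Types x y z : tensor A B.

Definition tens_mul x y : tensor A B :=
  tens_lift (fun a b => tens_lift (fun a' b' => tens (a * a') (b * b')) y) x.
Definition tens_one : tensor A B := tens 1 1.

Let mulb a b : balanced (fun (a' : A) (b' : B) => tens (a * a') (b * b')).
Proof.
split=> [u1 u2 v|u v1 v2|r u v]; rewrite ?mulrDr ?tensDl ?tensDr //.
by rewrite -ascaleAr tens_bal ascaleAr.
Qed.

Let mulb2 y :
  balanced (fun a b => tens_lift (fun a' b' => tens (a * a') (b * b')) y).
Proof.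
split=> [u1 u2 v|u v1 v2|r u v].
- by rewrite -tens_lift_add; apply: eq_tens_lift => a' b'; rewrite mulrDl tensDl.
- by rewrite -tens_lift_add; apply: eq_tens_lift => a' b'; rewrite mulrDl tensDr.
by apply: eq_tens_lift => a' b'; rewrite -!ascaleAl tens_bal.
Qed.

Lemma tens_mulE a b a' b' :
  tens_mul (tens a b) (tens a' b') = tens (a * a') (b * b').
Proof. by rewrite /tens_mul tens_liftE // tens_liftE. Qed.

Lemma tens_mulDl : left_distributive tens_mul +%R.
Proof. by move=> x y z; rewrite /tens_mul tens_liftD. Qed.

Lemma tens_mulDr : right_distributive tens_mul +%R.
Proof.
move=> x y z; rewrite /tens_mul -tens_lift_add.
by apply: eq_tens_lift => a b; rewrite tens_liftD.
Qed.

Lemma tens_mulA : associative tens_mul.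
Proof.
elim/tensP=> [a b|x x' IHx IHx']; last first.
  by move=> y z; rewrite !tens_mulDl IHx IHx'.
elim/tensP=> [a' b'|y y' IHy IHy']; last first.
  by move=> z; rewrite !(tens_mulDl, tens_mulDr) IHy IHy'.
elim/tensP=> [a'' b''|z z' IHz IHz']; last by rewrite !tens_mulDr IHz IHz'.
by rewrite !tens_mulE !mulrA.
Qed.

Lemma tens_mul1l : left_id tens_one tens_mul.
Proof.
elim/tensP=> [a b|x y IHx IHy]; first by rewrite tens_mulE !mul1r.
by rewrite tens_mulDr IHx IHy.
Qed.

Lemma tens_mul1r : right_id tens_one tens_mul.
Proof.
elim/tensP=> [a b|x y IHx IHy]; first by rewrite tens_mulE !mulr1.
by rewrite tens_mulDl IHx IHy.
Qed.

HB.instance Definition _ := GRing.Zmodule_isPzRing.Build (tensor A B)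
  tens_mulA tens_mul1l tens_mul1r tens_mulDl tens_mulDr.

Lemma mul_tens (a a' : A) (b b' : B) :
  tens a b * tens a' b' = tens (a * a') (b * b').
Proof. exact: tens_mulE. Qed.

Definition tens_in_ralg (r : R) : tensor A B := tens (in_ralg r) 1.

Lemma tens_in_ralgD : {morph tens_in_ralg : r s / r + s}.
Proof. by move=> r s; rewrite /tens_in_ralg in_ralgD tensDl. Qed.

Lemma tens_in_ralg1 : tens_in_ralg 1 = 1.
Proof. by rewrite /tens_in_ralg in_ralg1. Qed.

Lemma tens_in_ralgM : {morph tens_in_ralg : r s / r * s}.
Proof. by move=> r s; rewrite /tens_in_ralg in_ralgM mul_tens mulr1. Qed.

Lemma tens_in_ralgC r x : tens_in_ralg r * x = x * tens_in_ralg r.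
Proof.
elim/tensP: x => [a b|x y IHx IHy]; last by rewrite mulrDl mulrDr IHx IHy.
by rewrite !mul_tens in_ralgC mulr1 mul1r.
Qed.

HB.instance Definition _ := PzRing_isRAlg.Build R (tensor A B)
  tens_in_ralgD tens_in_ralg1 tens_in_ralgM tens_in_ralgC.

Lemma ascale_tensl r (a : A) (b : B) : r *:: tens a b = tens (r *:: a) b.
Proof. by rewrite /ascale mul_tens mul1r. Qed.

Lemma ascale_tensr r (a : A) (b : B) : r *:: tens a b = tens a (r *:: b).
Proof. by rewrite ascale_tensl tens_bal. Qed.

Lemma tens_lift_linear (C : ralgType R) (f : A -> B -> C) :
  balanced f -> (forall r a b, f (r *:: a) b = r *:: f a b) ->
  alinear (tens_lift f).
Proof.
move=> fb fZ; apply: alinearP => [|r x]; first exact: tens_liftD.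
elim/tensP: x => [u v|x z IHx IHz]; first by rewrite ascale_tensl !tens_liftE.
by rewrite ascaleDr !tens_liftD // IHx IHz ascaleDr.
Qed.

Lemma tensor_morphM (C : ralgType R) (h : tensor A B -> C) :
  {morph h : x y / x + y} ->
  (forall a b a' b',
     h (tens a b * tens a' b') = h (tens a b) * h (tens a' b')) ->
  {morph h : x y / x * y}.
Proof.
move=> hD hM x y.
elim/tensP: x => [a b|x x' IHx IHx']; last by rewrite mulrDl !hD mulrDl IHx IHx'.
elim/tensP: y => [a' b'|y y' IHy IHy']; last by rewrite mulrDr !hD mulrDr IHy IHy'.
exact: hM.
Qed.

End TensorAlgebra.

Section MatrixAlgebra.
Variables (R : comPzRingType) (n : nat).

Lemma mx_in_ralgC (r : R) (x : 'M[R]_n) : r%:M * x = x * r%:M.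
Proof. by rewrite -!mulmxE mul_scalar_mx mul_mx_scalar. Qed.

HB.instance Definition _ := PzRing_isRAlg.Build R 'M[R]_n
  (@raddfD _ _ (@scalar_mx R n)) erefl (@scalar_mxM R n) mx_in_ralgC.

Lemma ascalemxE (r : R) (x : 'M[R]_n) : r *:: x = r *: x.
Proof. exact: mul_scalar_mx. Qed.
End MatrixAlgebra.

Definition ralg_isom (R : comPzRingType) (A B : ralgType R) (f : A -> B) :=
  [/\ {morph f : x y / x + y}, f 1 = 1, {morph f : x y / x * y},
      forall r, f (in_ralg r) = in_ralg r & bijective f].

Section RalgIsom.
Variable R : comPzRingType.
Implicit Types A B C : ralgType R.

Lemma ralg_isomZ A B (f : A -> B) : ralg_isom f ->
  forall r x, f (r *:: x) = r *:: f x.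
Proof. by case=> _ _ fM fr _ r x; rewrite /ascale fM fr. Qed.

Lemma ralg_isom_id A : ralg_isom (@id A).
Proof. by split=> //; exists id. Qed.

Lemma ralg_isom_comp A B C (f : A -> B) (g : B -> C) :
  ralg_isom f -> ralg_isom g -> ralg_isom (fun x => g (f x)).
Proof.
case=> fD f1 fM fr fb [gD g1 gM gr gb]; split=> [x y||x y|r|].
- by rewrite fD gD.
- by rewrite f1 g1.
- by rewrite fM gM.
- by rewrite fr gr.
- exact: (bij_comp gb fb).
Qed.

Lemma ralg_isom_inv A B (f : A -> B) : ralg_isom f ->
  exists g : B -> A, [/\ cancel f g, cancel g f & ralg_isom g].
Proof.
case=> fD f1 fM fr [g fK gK]; exists g; split=> //; split=> [x y||x y|r|].
- by apply: (can_inj fK); rewrite fD !gK.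
- by apply: (can_inj fK); rewrite f1 gK.
- by apply: (can_inj fK); rewrite fM !gK.
- by apply: (can_inj fK); rewrite fr !gK.
- by exists f.
Qed.

End RalgIsom.

Section TensorMap.
Variables (R : comPzRingType) (A A' B B' : ralgType R).
Variables (f : A -> A') (g : B -> B').

Definition tens_map (x : tensor A B) : tensor A' B' :=
  tens_lift (fun a b => tens (f a) (g b)) x.

Hypotheses (fi : ralg_isom f) (gi : ralg_isom g).

Lemma tens_map_balanced : balanced (fun a b => tens (f a) (g b)).
Proof.
case: (fi) (gi) => [fD _ _ _ _] [gD _ _ _ _].
split=> [u1 u2 v|u v1 v2|r u v]; first by rewrite fD tensDl.
  by rewrite gD tensDr.
by rewrite (ralg_isomZ fi) (ralg_isomZ gi) tens_bal.
Qed.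

Lemma tens_mapE a b : tens_map (tens a b) = tens (f a) (g b).
Proof. exact: tens_liftE tens_map_balanced _ _. Qed.

Lemma tens_mapD : {morph tens_map : x y / x + y}.
Proof. exact: tens_liftD tens_map_balanced. Qed.

End TensorMap.

Lemma tens_map_isom (R : comPzRingType) (A A' B B' : ralgType R)
    (f : A -> A') (g : B -> B') :
  ralg_isom f -> ralg_isom g -> ralg_isom (tens_map f g).
Proof.
move=> fi gi; have [fD f1 fM fr _] := fi; have [gD g1 gM _ _] := gi.
have [f' [fK f'K f'i]] := ralg_isom_inv fi.
have [g' [gK g'K g'i]] := ralg_isom_inv gi.
split.
- exact: tens_mapD.
- by rewrite [1 in LHS]/(tens 1 1) tens_mapE // f1 g1.
- apply: tensor_morphM; first exact: tens_mapD.
  by move=> a b a' b'; rewrite mul_tens !tens_mapE // fM gM mul_tens.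
- by move=> r; rewrite [in_ralg r in LHS]/(tens _ 1) tens_mapE // fr g1.
exists (tens_map f' g').
  elim/tensP=> [a b|x y IHx IHy]; first by rewrite !tens_mapE // fK gK.
  by rewrite !tens_mapD // IHx IHy.
elim/tensP=> [a b|x y IHx IHy]; first by rewrite !tens_mapE // f'K g'K.
by rewrite !tens_mapD // IHx IHy.
Qed.

Section TensorComm.
Variables (R : comPzRingType) (A B : ralgType R).

Definition tens_swap (x : tensor A B) : tensor B A :=
  tens_lift (fun a b => tens b a) x.

Lemma tens_swap_balanced : balanced (fun (a : A) (b : B) => tens b a).
Proof.
by split=> [u1 u2 v|u v1 v2|r u v]; rewrite ?tensDr ?tensDl ?tens_bal.
Qed.

Lemma tens_swapE a b : tens_swap (tens a b) = tens b a.
Proof. exact: tens_liftE tens_swap_balanced _ _. Qed.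

Lemma tens_swapD : {morph tens_swap : x y / x + y}.
Proof. exact: tens_liftD tens_swap_balanced. Qed.
End TensorComm.

Lemma tens_swapK (R : comPzRingType) (A B : ralgType R) :
  cancel (@tens_swap R A B) (@tens_swap R B A).
Proof.
elim/tensP=> [a b|x y IHx IHy]; first by rewrite !tens_swapE.
by rewrite !tens_swapD IHx IHy.
Qed.

Lemma tens_swap_isom (R : comPzRingType) (A B : ralgType R) :
  ralg_isom (@tens_swap R A B).
Proof.
split.
- exact: tens_swapD.
- by rewrite [1 in LHS]/(tens 1 1) tens_swapE.
- apply: tensor_morphM; first exact: tens_swapD.
  by move=> a b a' b'; rewrite mul_tens !tens_swapE mul_tens.
- move=> r; rewrite [in_ralg r in LHS]/(tens _ 1) tens_swapE.
  by rewrite [in RHS]/in_ralg /= /tens_in_ralg -!ascaler1 tens_bal.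
- by exists (@tens_swap R B A); apply: tens_swapK.
Qed.

Section TensorAssoc.
Variables (R : comPzRingType) (A B C : ralgType R).

Let assoc1 (c : C) (x : tensor A B) : tensor A (tensor B C) :=
  tens_lift (fun a b => tens a (tens b c)) x.

Let assoc1_balanced c :
  balanced (fun (a : A) (b : B) => tens a (tens b c) : tensor A (tensor B C)).
Proof.
split=> [u1 u2 v|u v1 v2|r u v]; rewrite ?tensDl ?tensDr //.
by rewrite tens_bal ascale_tensl.
Qed.

Definition tens_assoc (x : tensor (tensor A B) C) : tensor A (tensor B C) :=
  tens_lift (fun y c => assoc1 c y) x.

Let assoc_balanced : balanced (fun y c => assoc1 c y).
Proof.
split=> [y1 y2 c|y c1 c2|r y c].
- exact: (tens_liftD (assoc1_balanced c)).
- rewrite /assoc1 -tens_lift_add; apply: eq_tens_lift => a b.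
  by rewrite !tensDr.
- elim/tensP: y => [a b|x y IHx IHy].
    rewrite ascale_tensl /assoc1 !tens_liftE //.
    by rewrite tens_bal ascale_tensr.
  move: IHx IHy; rewrite ascaleDr /assoc1 => IHx IHy.
  by rewrite !(tens_liftD (assoc1_balanced _)) IHx IHy.
Qed.

Lemma tens_assocE a b c : tens_assoc (tens (tens a b) c) = tens a (tens b c).
Proof. by rewrite /tens_assoc tens_liftE // /assoc1 tens_liftE. Qed.

Lemma tens_assocD : {morph tens_assoc : x y / x + y}.
Proof. exact: tens_liftD assoc_balanced. Qed.

Let assocV1 (a : A) (x : tensor B C) : tensor (tensor A B) C :=
  tens_lift (fun b c => tens (tens a b) c) x.

Let assocV1_balanced a :
  balanced (fun (b : B) (c : C) => tens (tens a b) c : tensor (tensor A B) C).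
Proof.
split=> [u1 u2 v|u v1 v2|r u v]; rewrite ?tensDr ?tensDl //.
by rewrite -ascale_tensr tens_bal.
Qed.

Definition tens_assocV (x : tensor A (tensor B C)) : tensor (tensor A B) C :=
  tens_lift assocV1 x.

Let assocV_balanced : balanced assocV1.
Proof.
split=> [a1 a2 y|a y1 y2|r a y].
- rewrite /assocV1 -tens_lift_add; apply: eq_tens_lift => b c.
  by rewrite !tensDl.
- exact: (tens_liftD (assocV1_balanced a)).
- elim/tensP: y => [b c|x y IHx IHy].
    by rewrite ascale_tensl /assocV1 !tens_liftE // tens_bal.
  move: IHx IHy; rewrite ascaleDr /assocV1 => IHx IHy.
  by rewrite !(tens_liftD (assocV1_balanced _)) IHx IHy.
Qed.

Lemma tens_assocVE a b c : tens_assocV (tens a (tens b c)) = tens (tens a b) c.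
Proof. by rewrite /tens_assocV tens_liftE // /assocV1 tens_liftE. Qed.

Lemma tens_assocVD : {morph tens_assocV : x y / x + y}.
Proof. exact: tens_liftD assocV_balanced. Qed.

Lemma tensP3l (P : tensor (tensor A B) C -> Prop) :
  (forall a b c, P (tens (tens a b) c)) ->
  (forall x y, P x -> P y -> P (x + y)) -> forall x, P x.
Proof.
move=> Pt PD; elim/tensP=> // y c.
by elim/tensP: y => // x y IHx IHy; rewrite tensDl; apply: PD.
Qed.

Lemma tensP3r (P : tensor A (tensor B C) -> Prop) :
  (forall a b c, P (tens a (tens b c))) ->
  (forall x y, P x -> P y -> P (x + y)) -> forall x, P x.
Proof.
move=> Pt PD; elim/tensP=> // a y.
by elim/tensP: y => // x y IHx IHy; rewrite tensDr; apply: PD.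
Qed.

Lemma tens_assoc_isom : ralg_isom tens_assoc.
Proof.
split.
- exact: tens_assocD.
- by rewrite [1 in LHS]/(tens (tens 1 1) 1) tens_assocE.
- elim/tensP3l=> [a b c|x x' IHx IHx'] y; last first.
    by rewrite mulrDl !tens_assocD IHx IHx' mulrDl.
  elim/tensP3l: y => [a' b' c'|y y' IHy IHy']; last first.
    by rewrite mulrDr !tens_assocD IHy IHy' mulrDr.
  by rewrite !tens_assocE !mul_tens tens_assocE.
- by move=> r; rewrite [in_ralg r in LHS]/(tens (tens _ 1) 1) tens_assocE.
exists tens_assocV.
  elim/tensP3l=> [a b c|x y IHx IHy]; first by rewrite tens_assocE tens_assocVE.
  by rewrite tens_assocD tens_assocVD IHx IHy.
elim/tensP3r=> [a b c|x y IHx IHy]; first by rewrite tens_assocVE tens_assocE.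
by rewrite tens_assocVD tens_assocD IHx IHy.
Qed.

End TensorAssoc.

Section TensorUnit.
Variables (R : comPzRingType) (A : ralgType R).

Definition tens_unit (x : tensor 'M[R]_1 A) : A :=
  tens_lift (fun (m : 'M[R]_1) (a : A) => m 0 0 *:: a) x.

Let unit_balanced : balanced (fun (m : 'M[R]_1) (a : A) => m 0 0 *:: a).
Proof.
split=> [u1 u2 v|u v1 v2|r u v]; first by rewrite mxE ascaleDl.
  by rewrite ascaleDr.
by rewrite ascalemxE mxE ascaleA mulrC.
Qed.

Lemma tens_unitE m a : tens_unit (tens m a) = m 0 0 *:: a.
Proof. exact: tens_liftE unit_balanced _ _. Qed.

Lemma tens_unitD : {morph tens_unit : x y / x + y}.
Proof. exact: tens_liftD unit_balanced. Qed.

Lemma tens_unit_isom : ralg_isom tens_unit.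
Proof.
split.
- exact: tens_unitD.
- by rewrite [1 in LHS]/(tens 1 1) tens_unitE mxE ascale1.
- apply: tensor_morphM; first exact: tens_unitD.
  move=> m a m' a'; rewrite mul_tens !tens_unitE -mulmxE mxE big_ord1.
  by rewrite -ascaleAl -ascaleAr ascaleA.
- move=> r; rewrite [in_ralg r in LHS]/(tens (r%:M) 1) tens_unitE.
  by rewrite mxE eqxx mulr1n ascaler1.
exists (fun a => tens 1 a).
  elim/tensP=> [m a|x y IHx IHy]; last by rewrite tens_unitD tensDr IHx IHy.
  rewrite tens_unitE -tens_bal; congr tens; apply/matrixP=> i j.
  by rewrite ascalemxE !ord1 !mxE mulr1.
by move=> a; rewrite tens_unitE mxE ascale1.
Qed.

End TensorUnit.

Record derivation (A : pzRingType) := Derivation {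
  der_fun :> A -> A;
  derD : {morph der_fun : x y / x + y};
  derM : forall x y, der_fun (x * y) = der_fun x * y + x * der_fun y
}.

Lemma der0 (A : pzRingType) (D : derivation A) : D 0 = 0.
Proof. exact: morphD0 (@derD _ D). Qed.

Section TensorDerivation.
Variables (R : comPzRingType) (DR : derivation R) (A B : ralgType R).
Variables (DA : derivation A) (DB : derivation B).
Hypothesis DAR : forall r, DA (in_ralg r) = in_ralg (DR r).
Hypothesis DBR : forall r, DB (in_ralg r) = in_ralg (DR r).

Definition tens_der_fun (x : tensor A B) : tensor A B :=
  tens_lift (fun a b => tens (DA a) b + tens a (DB b)) x.

Lemma tens_der_balanced : balanced (fun a b => tens (DA a) b + tens a (DB b)).
Proof.
split=> [u1 u2 v|u v1 v2|r u v].
- by rewrite derD !tensDl addrACA.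
- by rewrite derD !tensDr addrACA.
- rewrite {1 3}/ascale !derM DAR DBR -!/(ascale _ _) tensDl tensDr !tens_bal.
  by rewrite -!addrA addrCA.
Qed.

Lemma tens_der_funE a b :
  tens_der_fun (tens a b) = tens (DA a) b + tens a (DB b).
Proof. exact: tens_liftE tens_der_balanced _ _. Qed.

Lemma tens_der_funD : {morph tens_der_fun : x y / x + y}.
Proof. exact: tens_liftD tens_der_balanced. Qed.

Lemma tens_der_funM x y :
  tens_der_fun (x * y) = tens_der_fun x * y + x * tens_der_fun y.
Proof.
elim/tensP: x => [a b|x x' IHx IHx']; last first.
  by rewrite mulrDl !tens_der_funD IHx IHx' !mulrDl addrACA.
elim/tensP: y => [a' b'|y y' IHy IHy']; last first.
  by rewrite mulrDr !tens_der_funD IHy IHy' !mulrDr addrACA.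
rewrite mul_tens !tens_der_funE !derM mulrDl mulrDr !mul_tens tensDl tensDr.
by rewrite addrACA.
Qed.

(* D_A (x) 1 + 1 (x) D_B *)
Definition tens_der : derivation (tensor A B) :=
  Derivation tens_der_funD tens_der_funM.

Lemma tens_derE a b : tens_der (tens a b) = tens (DA a) b + tens a (DB b).
Proof. exact: tens_der_funE. Qed.

Lemma tens_der_ext r : tens_der (in_ralg r) = in_ralg (DR r).
Proof.
have DB1 : DB 1 = 0.
  by have := derM DB 1 1; rewrite !(mulr1, mul1r) -[X in X = _]add0r => /addIr.
rewrite [in_ralg r]/(tens (in_ralg r) 1) tens_derE DAR DB1.
by rewrite tens0r addr0.
Qed.
End TensorDerivation.

Lemma addr_regroup (V : zmodType) (a b c d e f : V) :
  a + b + (c + d) - (e + f) = (a + c - e) + (b + d - f).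
Proof. by rewrite opprD (addrACA a) (addrACA (a + c)). Qed.

Section MatrixDerivation.
Variables (R : comPzRingType) (D : derivation R) (n : nat) (Z : 'M[R]_n).

Let regroup2 (V : zmodType) (p q s t u : V) :
  p + q + s - t = (p + s - u) + (q + u - t).
Proof. by rewrite -addr_regroup addrA opprD addrA addrK. Qed.

Definition mx_der_fun (Y : 'M[R]_n) : 'M[R]_n := map_mx D Y + Z * Y - Y * Z.

Lemma mx_der_funD : {morph mx_der_fun : X Y / X + Y}.
Proof.
move=> X Y; rewrite /mx_der_fun.
have -> : map_mx D (X + Y) = map_mx D X + map_mx D Y.
  by apply/matrixP=> i j; rewrite !mxE derD.
by rewrite mulrDl mulrDr addr_regroup.
Qed.

Lemma mx_der_funM X Y : mx_der_fun (X * Y) = mx_der_fun X * Y + X * mx_der_fun Y.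
Proof.
rewrite /mx_der_fun.
have -> : map_mx D (X * Y) = map_mx D X * Y + X * map_mx D Y.
  apply/matrixP=> i j; rewrite -!mulmxE !mxE (morphD_sum (@derD _ D)).
  by rewrite -big_split; apply: eq_bigr => k _; rewrite derM !mxE.
rewrite !(mulrDl, mulrDr, mulNr, mulrN) !mulrA.
exact: regroup2.
Qed.

Definition mx_der : derivation 'M[R]_n := Derivation mx_der_funD mx_der_funM.

Lemma mx_der_ext r : mx_der (in_ralg r) = in_ralg (D r).
Proof.
rewrite /= /mx_der_fun -in_ralgC addrK; apply/matrixP=> i j.
by rewrite !mxE; case: eqP => // _; rewrite !mulr0n der0.
Qed.
End MatrixDerivation.

(* A is a direct summand of a free module R^n. *)
Definition fg_projective (R : comPzRingType) (A : ralgType R) : Prop :=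
  exists (n : nat) (i : A -> 'rV[R]_n) (p : 'rV[R]_n -> A),
  [/\ forall r x y, i (r *:: x + y) = r *: i x + i y,
      forall r u v, p (r *: u + v) = r *:: p u + p v
    & cancel i p].

Definition faithful (R : comPzRingType) (A : ralgType R) : Prop :=
  forall r : R, (forall x : A, r *:: x = 0) -> r = 0.

(* The map A (x) A^op -> End_R(A), a (x) b |-> (x |-> a x b); the R-module
   underlying A (x) A^op is tensor A A. *)
Definition sandwich (R : comPzRingType) (A : ralgType R) (t : tensor A A)
    (x : A) : A :=
  tens_lift (fun a b => a * x * b) t.

(* The last condition says that sandwich is a bijection from A (x) A^op onto
   the R-linear endomorphisms of A. *)
Definition is_azumaya (R : comPzRingType) (A : ralgType R) : Prop :=
  [/\ fg_projective A, faithful A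
    & forall f : A -> A, alinear f -> exists! t : tensor A A, sandwich t = f].

Section Sandwich.
Variables (R : comPzRingType) (A : ralgType R).
Implicit Types (t : tensor A A) (x : A).

Lemma sandwich_balanced x : balanced (fun a b : A => a * x * b).
Proof.
split=> [u1 u2 v|u v1 v2|r u v]; rewrite ?mulrDl ?mulrDr //.
by rewrite -!ascaleAl -ascaleAr.
Qed.

Lemma sandwichE a b x : sandwich (tens a b) x = a * x * b.
Proof. exact: tens_liftE (sandwich_balanced x) _ _. Qed.

Lemma sandwichD t t' x : sandwich (t + t') x = sandwich t x + sandwich t' x.
Proof. exact: tens_liftD (sandwich_balanced x) _ _. Qed.

Lemma sandwich_sum (I : Type) (s : seq I) (P : pred I) (F : I -> tensor A A) x :
  sandwich (\sum_(i <- s | P i) F i) x = \sum_(i <- s | P i) sandwich (F i) x.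
Proof.
have h : {morph (fun t => sandwich t x) : t t' / t + t'} by move=> t t'; apply: sandwichD.
exact: (morphD_sum h).
Qed.

Lemma sandwichZ r t x : sandwich (r *:: t) x = r *:: sandwich t x.
Proof.
elim/tensP: t => [a b|t t' IHt IHt'].
  by rewrite ascale_tensl !sandwichE -!ascaleAl.
by rewrite ascaleDr !sandwichD IHt IHt' ascaleDr.
Qed.

Lemma sandwich_linear t : alinear (sandwich t).
Proof.
move=> r x y; elim/tensP: t => [a b|t t' IHt IHt'].
  by rewrite !sandwichE mulrDr mulrDl -ascaleAr -ascaleAl.
by rewrite !sandwichD IHt IHt' ascaleDr addrACA.
Qed.

Lemma sandwich_bijP (G : (A -> A) -> tensor A A) :
  (forall t, G (sandwich t) = t) ->
  (forall f, alinear f -> sandwich (G f) = f) ->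
  forall f : A -> A, alinear f -> exists! t : tensor A A, sandwich t = f.
Proof.
move=> GK KG f lf; exists (G f); split; first exact: KG.
by move=> t <-; rewrite GK.
Qed.

End Sandwich.

Section DualBasis.
Variables (R : comPzRingType) (A : ralgType R).

Lemma dual_basis : fg_projective A ->
  exists (n : nat) (phi : 'I_n -> A -> R) (e : 'I_n -> A),
  (forall k r x y, phi k (r *:: x + y) = r * phi k x + phi k y) /\
  (forall x, x = \sum_k phi k x *:: e k).
Proof.
case=> n [i [p [iL pL ip]]].
exists n, (fun k x => i x 0 k), (fun k => p (delta_mx 0 k)); split.
  by move=> k r x y; rewrite iL !mxE.
move=> x; rewrite -{1}[x]ip {1}(row_sum_delta (i x)).
have pD : {morph p : u v / u + v}.
  by move=> u v; have := pL 1 u v; rewrite scale1r ascale1.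
rewrite (morphD_sum pD); apply: eq_bigr => k _.
by have := pL (i x 0 k) (delta_mx 0 k) 0; rewrite (morphD0 pD) !addr0.
Qed.

Lemma dual_basis_fg (I : finType) (phi : I -> A -> R) (e : I -> A) :
  (forall k r x y, phi k (r *:: x + y) = r * phi k x + phi k y) ->
  (forall x, x = \sum_k phi k x *:: e k) -> fg_projective A.
Proof.
move=> phiL phiE; exists #|I|, (fun x => \row_k phi (enum_val k) x).
exists (fun u => \sum_k u 0 k *:: e (enum_val k)); split.
- by move=> r x y; apply/rowP=> k; rewrite !mxE phiL.
- move=> r u v; rewrite ascale_sumr -big_split; apply: eq_bigr => k _ /=.
  by rewrite !mxE ascaleDl ascaleA.
move=> x; rewrite [RHS]phiE (reindex (@enum_val I I)) /=; last first.
  exact/onW_bij/enum_val_bij.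
by apply: eq_bigr => k _; rewrite mxE.
Qed.

End DualBasis.

Section MatrixAzumaya.
Variables (R : comPzRingType) (n : nat).
Local Notation e := (fun i j => delta_mx i j : 'M[R]_n).

Let mul_delta_l (b : 'M[R]_n) i j k l : e i j * b * e k l = b j k *: e i l.
Proof.
rewrite -!mulmxE (matrix_sum_delta b) mulmx_sumr mulmx_suml (bigD1 j) //=.
rewrite [X in _ + X]big1 => [|p pj]; last first.
  rewrite mulmx_sumr mulmx_suml big1 // => q _.
  by rewrite -scalemxAr mul_delta_mx_cond eq_sym (negPf pj) mulr0n scaler0 mul0mx.
rewrite addr0 mulmx_sumr mulmx_suml (bigD1 k) //= [X in _ + X]big1 => [|q qk].
  rewrite addr0 -scalemxAr mul_delta_mx -scalemxAl mul_delta_mx.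
  by rewrite -matrix_sum_delta.
by rewrite -scalemxAr mul_delta_mx -scalemxAl mul_delta_mx_cond (negPf qk)
  mulr0n scaler0.
Qed.

Lemma mx_azumaya : (0 < n)%N -> is_azumaya ('M[R]_n : ralgType R).
Proof.
move=> n_gt0; split.
- apply: (@dual_basis_fg _ _ ('I_n * 'I_n)%type
    (fun ij (x : 'M[R]_n) => x ij.1 ij.2) (fun ij => e ij.1 ij.2)).
    by move=> [i j] r x y /=; rewrite ascalemxE !mxE.
  move=> x; rewrite {1}[x]matrix_sum_delta pair_big /=.
  by apply: eq_bigr => p _; rewrite ascalemxE.
- move=> r /(_ 1) /matrixP /(_ (Ordinal n_gt0) (Ordinal n_gt0)).
  by rewrite ascalemxE !mxE eqxx mulr1.
apply: (@sandwich_bijP _ _ (fun f =>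
  \sum_i \sum_j \sum_k tens (f (e i j) * e k i) (e j k))).
- elim/tensP=> [a b|t t' IHt IHt']; last first.
    rewrite -[in RHS]IHt -[in RHS]IHt'.
    rewrite -big_split; apply: eq_bigr => i _; rewrite -big_split.
    apply: eq_bigr => j _; rewrite -big_split; apply: eq_bigr => k _ /=.
    by rewrite sandwichD mulrDl tensDl.
  transitivity (\sum_i \sum_j \sum_k tens (a * e i i) (b j k *: e j k)).
    apply: eq_bigr => i _; apply: eq_bigr => j _; apply: eq_bigr => k _.
    rewrite sandwichE -!mulrA (mulrA (e i j)) mul_delta_l -!ascalemxE.
    by rewrite -ascaleAr tens_bal.
  transitivity (\sum_i tens (a * e i i) b).
    apply: eq_bigr => i _; rewrite {2}(matrix_sum_delta b) tens_sumr.
    by apply: eq_bigr => j _; rewrite tens_sumr.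
  by rewrite -tens_suml -mulr_sumr -mx1_sum_delta mulr1.
move=> f lf; apply/funext => x; rewrite sandwich_sum.
rewrite {2}(matrix_sum_delta x) (morphD_sum (linD lf)); apply: eq_bigr => i _.
rewrite sandwich_sum (morphD_sum (linD lf)); apply: eq_bigr => j _.
rewrite sandwich_sum -ascalemxE (linZ lf) ascalemxE.
transitivity (\sum_k x i j *: (f (e i j) * e k k)).
  apply: eq_bigr => k _; rewrite sandwichE -!mulrA (mulrA (e k i)) mul_delta_l.
  by rewrite -!ascalemxE ascaleAr.
by rewrite -scaler_sumr -mulr_sumr -mx1_sum_delta mulr1.
Qed.

End MatrixAzumaya.

Section TensorAzumaya.
Variables (R : comPzRingType) (A B : ralgType R).

Section Inverse.
Variable (C : ralgType R).
Hypothesis azC : is_azumaya C.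

Let sex (f : C -> C) : exists t : tensor C C, alinear f -> sandwich t = f.
Proof.
have [lf|nlf] := pselect (alinear f); last by exists 0.
by case: azC => _ _ /(_ f lf) [t [tf _]]; exists t.
Qed.

Definition sandwichV (f : C -> C) : tensor C C := sval (cid (sex f)).

Lemma sandwichVK f : alinear f -> sandwich (sandwichV f) = f.
Proof. exact: (svalP (cid (sex f))). Qed.

Lemma sandwich_inj : injective (@sandwich R C).
Proof.
move=> t t' tt'; case: azC => _ _ /(_ _ (sandwich_linear t)) [w [_ wP]].
by rewrite -(wP t) // -(wP t').
Qed.

End Inverse.

Hypotheses (azA : is_azumaya A) (azB : is_azumaya B).

Let faithfulT : faithful (tensor A B).
Proof.
case: azA azB => [/dual_basis [n [phi [e [phiL phiE]]]] fA _] [_ fB _] r r0.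
apply: fA => x; rewrite (phiE x) ascale_sumr big1 // => k _; rewrite ascaleA.
suff -> : r * phi k x = 0 by rewrite /ascale (morphD0 (@in_ralgD R A)) mul0r.
apply: fB => b.
have pD : {morph phi k : u v / u + v}.
  by move=> u v; have := phiL k 1 u v; rewrite ascale1 mul1r.
have pZ s u : phi k (s *:: u) = s * phi k u.
  by have := phiL k s u 0; rewrite (morphD0 pD) !addr0.
have pb : balanced (fun (a : A) (b : B) => phi k a *:: b).
  split=> [u1 u2 v|u v1 v2|s u v]; first by rewrite pD ascaleDl.
    by rewrite ascaleDr.
  by rewrite pZ ascaleA mulrC.
have := congr1 (tens_lift (fun (a : A) (b : B) => phi k a *:: b)) (r0 (tens x b)).
by rewrite ascale_tensl tens_liftE // pZ (morphD0 (tens_liftD pb)).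
Qed.

Let shuffle1 (a a' : A) (y : tensor B B) : tensor (tensor A B) (tensor A B) :=
  tens_lift (fun b b' => tens (tens a b) (tens a' b')) y.

Let shuffle1b a a' : balanced (fun (b b' : B) =>
  tens (tens a b) (tens a' b') : tensor (tensor A B) (tensor A B)).
Proof.
split=> [u1 u2 v|u v1 v2|r u v]; rewrite ?tensDr ?tensDl ?tensDr //.
by rewrite -(ascale_tensr r a u) -(ascale_tensr r a' v) tens_bal.
Qed.

Let shuffle (x : tensor A A) (y : tensor B B) :
    tensor (tensor A B) (tensor A B) :=
  tens_lift (fun a a' => shuffle1 a a' y) x.

Let shuffleb y : balanced (fun a a' => shuffle1 a a' y).
Proof.
split=> [u1 u2 v|u v1 v2|r u v]; rewrite /shuffle1 -?tens_lift_add;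
  apply: eq_tens_lift => b b'.
- by rewrite !tensDl.
- by rewrite tensDl tensDr.
- by rewrite -(ascale_tensl r u b) -(ascale_tensl r v b') tens_bal.
Qed.

Let shuffleE a a' b b' :
  shuffle (tens a a') (tens b b') = tens (tens a b) (tens a' b').
Proof. by rewrite /shuffle tens_liftE // /shuffle1 tens_liftE. Qed.

Let shuffleDl x x' y : shuffle (x + x') y = shuffle x y + shuffle x' y.
Proof. exact: tens_liftD (shuffleb y) _ _. Qed.

Let shuffleDr x y y' : shuffle x (y + y') = shuffle x y + shuffle x y'.
Proof.
rewrite /shuffle -tens_lift_add; apply: eq_tens_lift => a a'.
exact: tens_liftD (shuffle1b _ _) _ _.
Qed.

Let shuffle_bal r x y : shuffle (r *:: x) y = shuffle x (r *:: y).
Proof.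
elim/tensP: x => [a a'|x x' IHx IHx']; last first.
  by rewrite ascaleDr !shuffleDl IHx IHx'.
elim/tensP: y => [b b'|y y' IHy IHy']; last first.
  by rewrite ascaleDr !shuffleDr IHy IHy'.
rewrite (ascale_tensl r a) (ascale_tensl r b) !shuffleE.
by rewrite -(ascale_tensl r a) -(ascale_tensr r a).
Qed.

Let sandwich_shuffle x y a b :
  sandwich (shuffle x y) (tens a b) = tens (sandwich x a) (sandwich y b).
Proof.
elim/tensP: x => [a1 a2|x x' IHx IHx']; last first.
  by rewrite shuffleDl !sandwichD IHx IHx' tensDl.
elim/tensP: y => [b1 b2|y y' IHy IHy']; last first.
  by rewrite shuffleDr !sandwichD IHy IHy' tensDr.
by rewrite shuffleE !sandwichE !mul_tens.
Qed.

Lemma tensor_azumaya : is_azumaya (tensor A B).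
Proof.
have [fgA _ _] := azA; have [fgB _ _] := azB.
have [n [phi [u [phiL phiE]]]] := dual_basis fgA.
have [m [psi [v [psiL psiE]]]] := dual_basis fgB.
have phiD k : {morph phi k : x y / x + y}.
  by move=> x y; have := phiL k 1 x y; rewrite ascale1 mul1r.
have phiZ k s x : phi k (s *:: x) = s * phi k x.
  by have := phiL k s x 0; rewrite (morphD0 (phiD k)) !addr0.
have psiD k : {morph psi k : x y / x + y}.
  by move=> x y; have := psiL k 1 x y; rewrite ascale1 mul1r.
have psiZ k s x : psi k (s *:: x) = s * psi k x.
  by have := psiL k s x 0; rewrite (morphD0 (psiD k)) !addr0.
split.
- have chib (k : 'I_n * 'I_m) : balanced (fun a b => phi k.1 a * psi k.2 b).
    split=> [x y z|x y z|r x y]; first by rewrite phiD mulrDl.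
      by rewrite psiD mulrDr.
    by rewrite phiZ psiZ mulrCA mulrA.
  apply: (@dual_basis_fg _ _ ('I_n * 'I_m)%type
    (fun k => tens_lift (fun a b => phi k.1 a * psi k.2 b))
    (fun k => tens (u k.1) (v k.2))).
    move=> k r x y; rewrite tens_liftD //; congr (_ + _).
    elim/tensP: x => [a b|x x' IHx IHx']; last first.
      by rewrite ascaleDr !tens_liftD // IHx IHx' mulrDr.
    by rewrite ascale_tensl !tens_liftE // phiZ mulrA.
  elim/tensP=> [a b|x y IHx IHy]; last first.
    rewrite {1}IHx {1}IHy -big_split; apply: eq_bigr => k _.
    by rewrite tens_liftD // ascaleDl.
  transitivity (\sum_i \sum_j (phi i a * psi j b) *:: tens (u i) (v j)).
    rewrite {1}(phiE a) tens_suml; apply: eq_bigr => i _.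
    rewrite {1}(psiE b) tens_sumr; apply: eq_bigr => j _.
    by rewrite -ascale_tensl -ascale_tensr ascaleA.
  by rewrite pair_bigA; apply: eq_bigr => k _; rewrite tens_liftE.
- exact: faithfulT.
have lA i x : alinear (fun z => phi i z *:: x).
  by move=> r z z'; rewrite phiL ascaleDl ascaleA.
have lB j y : alinear (fun z => psi j z *:: y).
  by move=> r z z'; rewrite psiL ascaleDl ascaleA.
pose sA i x := sandwichV azA (fun z => phi i z *:: x).
pose sB j y := sandwichV azB (fun z => psi j z *:: y).
have sAE i x z : sandwich (sA i x) z = phi i z *:: x by rewrite sandwichVK.
have sBE j y z : sandwich (sB j y) z = psi j z *:: y by rewrite sandwichVK.
have sAD i : {morph sA i : x y / x + y}.
  move=> x y; apply: (sandwich_inj azA); apply/funext => z.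
  by rewrite sandwichD !sAE ascaleDr.
have sBD j : {morph sB j : x y / x + y}.
  move=> x y; apply: (sandwich_inj azB); apply/funext => z.
  by rewrite sandwichD !sBE ascaleDr.
have sAZ i r x : sA i (r *:: x) = r *:: sA i x.
  apply: (sandwich_inj azA); apply/funext => z.
  by rewrite sandwichZ !sAE !ascaleA mulrC.
have sBZ j r x : sB j (r *:: x) = r *:: sB j x.
  apply: (sandwich_inj azB); apply/funext => z.
  by rewrite sandwichZ !sBE !ascaleA mulrC.
have gb i j : balanced (fun x y => shuffle (sA i x) (sB j y)).
  split=> [x x' y|x y y'|r x y]; first by rewrite sAD shuffleDl.
    by rewrite sBD shuffleDr.
  by rewrite sAZ sBZ shuffle_bal.
pose g i j := tens_lift (fun x y => shuffle (sA i x) (sB j y)).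
have gD i j : {morph g i j : x y / x + y} by apply: tens_liftD.
have gE i j x y : g i j (tens x y) = shuffle (sA i x) (sB j y).
  exact: tens_liftE.
apply: (@sandwich_bijP _ _ (fun F => \sum_i \sum_j g i j (F (tens (u i) (v j))))).
- elim/tensP=> [t t'|t t' IHt IHt']; last first.
    rewrite -[in RHS]IHt -[in RHS]IHt' -big_split; apply: eq_bigr => i _.
    by rewrite -big_split; apply: eq_bigr => j _; rewrite sandwichD gD.
  elim/tensP: t => [a b|t1 t2 IH1 IH2]; last first.
    rewrite tensDl -[in RHS]IH1 -[in RHS]IH2 -big_split; apply: eq_bigr => i _.
    by rewrite -big_split; apply: eq_bigr => j _; rewrite sandwichD gD.
  elim/tensP: t' => [a' b'|t1 t2 IH1 IH2]; last first.
    rewrite tensDr -[in RHS]IH1 -[in RHS]IH2 -big_split; apply: eq_bigr => i _.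
    by rewrite -big_split; apply: eq_bigr => j _; rewrite sandwichD gD.
  have sA_sum : \sum_i sA i (a * u i * a') = tens a a'.
    apply: (sandwich_inj azA); apply/funext => z.
    rewrite sandwich_sum sandwichE {2}(phiE z) mulr_sumr mulr_suml.
    by apply: eq_bigr => i _; rewrite sAE -ascaleAr -ascaleAl.
  have sB_sum : \sum_j sB j (b * v j * b') = tens b b'.
    apply: (sandwich_inj azB); apply/funext => z.
    rewrite sandwich_sum sandwichE {2}(psiE z) mulr_sumr mulr_suml.
    by apply: eq_bigr => j _; rewrite sBE -ascaleAr -ascaleAl.
  rewrite -[RHS]shuffleE -sA_sum -sB_sum.
  rewrite (@morphD_sum _ _ (shuffle^~ _)) => [|x y]; last exact: shuffleDl.
  apply: eq_bigr => i _.
  rewrite (@morphD_sum _ _ (shuffle _)) => [|x y]; last exact: shuffleDr.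
  by apply: eq_bigr => j _; rewrite sandwichE !mul_tens gE.
move=> F lF; apply/funext; elim/tensP=> [a b|x y IHx IHy]; last first.
  by rewrite (linD lF) (linD (sandwich_linear _)) IHx IHy.
have key i j w :
    sandwich (g i j w) (tens a b) = (phi i a * psi j b) *:: w.
  elim/tensP: w => [x y|x y IHx IHy]; last first.
    by rewrite gD sandwichD IHx IHy ascaleDr.
  by rewrite gE sandwich_shuffle sAE sBE -ascale_tensl -ascale_tensr ascaleA.
rewrite sandwich_sum {2}(phiE a) tens_suml (morphD_sum (linD lF)).
apply: eq_bigr => i _; rewrite sandwich_sum {2}(psiE b) tens_sumr.
rewrite (morphD_sum (linD lF)); apply: eq_bigr => j _; rewrite key.
by rewrite -ascale_tensl -ascale_tensr ascaleA (linZ lF).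
Qed.

End TensorAzumaya.
Section Kronecker.
Variables (R : comPzRingType) (m n : nat).
Implicit Types (a : 'M[R]_m) (b : 'M[R]_n).

Definition kron_idx (x : 'I_(m * n)) : 'I_m * 'I_n :=
  enum_val (cast_ord (esym (mxvec_cast m n)) x).

Lemma kron_idx_bij : bijective kron_idx.
Proof.
exists (fun p => cast_ord (mxvec_cast m n) (enum_rank p)) => [x|p].
  by rewrite /kron_idx enum_valK cast_ordKV.
by rewrite /kron_idx cast_ordK enum_rankK.
Qed.

Lemma kron_sum (V : zmodType) (F : 'I_m * 'I_n -> V) :
  \sum_x F (kron_idx x) = \sum_i \sum_k F (i, k).
Proof.
rewrite pair_bigA (reindex kron_idx) /=; last exact/onW_bij/kron_idx_bij.
by apply: eq_bigr => x _; case: (kron_idx x).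
Qed.

Definition kron a b : 'M[R]_(m * n) :=
  \matrix_(x, y) (a (kron_idx x).1 (kron_idx y).1 * b (kron_idx x).2 (kron_idx y).2).

Lemma kronDl a1 a2 b : kron (a1 + a2) b = kron a1 b + kron a2 b.
Proof. by apply/matrixP=> x y; rewrite !mxE mulrDl. Qed.

Lemma kronDr a b1 b2 : kron a (b1 + b2) = kron a b1 + kron a b2.
Proof. by apply/matrixP=> x y; rewrite !mxE mulrDr. Qed.

Lemma kronNl a b : kron (- a) b = - kron a b.
Proof. by apply/matrixP=> x y; rewrite !mxE mulNr. Qed.

Lemma kronNr a b : kron a (- b) = - kron a b.
Proof. by apply/matrixP=> x y; rewrite !mxE mulrN. Qed.

Lemma kronM a b a' b' : kron a b * kron a' b' = kron (a * a') (b * b').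
Proof.
apply/matrixP=> x y; rewrite -!mulmxE !mxE big_distrlr pair_bigA /=.
rewrite (reindex kron_idx) /=; last exact/onW_bij/kron_idx_bij.
by apply: eq_bigr => z _; rewrite !mxE mulrACA.
Qed.

Lemma kron_scalar r : kron r%:M 1%:M = r%:M.
Proof.
apply/matrixP=> x y; rewrite !mxE -(bij_eq kron_idx_bij x y).
move: (kron_idx x) (kron_idx y) => [i k] [j l] /=; rewrite xpair_eqE.
by case: eqP => _; case: eqP => _; rewrite ?mulr0n ?mulr1n ?mulr1 ?mulr0 ?mul0r.
Qed.

Lemma kron_balanced : balanced kron.
Proof.
split; [exact: kronDl | exact: kronDr | move=> r a b].
by apply/matrixP=> x y; rewrite !ascalemxE !mxE mulrCA mulrA.
Qed.

Definition tens_kron (x : tensor 'M[R]_m 'M[R]_n) : 'M[R]_(m * n) :=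
  tens_lift kron x.

Lemma tens_kronE a b : tens_kron (tens a b) = kron a b.
Proof. exact: tens_liftE kron_balanced _ _. Qed.

Lemma tens_kronD : {morph tens_kron : x y / x + y}.
Proof. exact: tens_liftD kron_balanced. Qed.

Let unkron (M : 'M[R]_(m * n)) : tensor 'M[R]_m 'M[R]_n :=
  \sum_x \sum_y M x y *:: tens (delta_mx (kron_idx x).1 (kron_idx y).1)
                               (delta_mx (kron_idx x).2 (kron_idx y).2).

Let unkronD : {morph unkron : M N / M + N}.
Proof.
move=> M N; rewrite /unkron -big_split; apply: eq_bigr => x _.
by rewrite -big_split; apply: eq_bigr => y _; rewrite mxE ascaleDl.
Qed.

Let tens_kronK : cancel tens_kron unkron.
Proof.
elim/tensP=> [a b|x y IHx IHy]; last by rewrite tens_kronD unkronD IHx IHy.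
rewrite tens_kronE /unkron.
pose F (p q : 'I_m * 'I_n) : tensor 'M[R]_m 'M[R]_n :=
  tens (a p.1 q.1 *: delta_mx p.1 q.1) (b p.2 q.2 *: delta_mx p.2 q.2).
transitivity (\sum_x \sum_y F (kron_idx x) (kron_idx y)).
  apply: eq_bigr => x _; apply: eq_bigr => y _.
  by rewrite mxE -ascaleA ascale_tensr ascale_tensl !ascalemxE.
rewrite {1}[a]matrix_sum_delta {1}[b]matrix_sum_delta.
rewrite (kron_sum (fun p => \sum_y F p (kron_idx y))) tens_suml.
transitivity (\sum_i \sum_k \sum_j \sum_l F (i, k) (j, l)).
  by apply: eq_bigr => i _; apply: eq_bigr => k _; apply: kron_sum.
apply: eq_bigr => i _; rewrite tens_suml.
under [RHS]eq_bigr do rewrite tens_sumr.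
rewrite [RHS]exchange_big; apply: eq_bigr => k _.
by apply: eq_bigr => j _; rewrite tens_sumr.
Qed.

Let unkronK : cancel unkron tens_kron.
Proof.
move=> M; rewrite /unkron (morphD_sum tens_kronD) {2}[M]matrix_sum_delta.
apply: eq_bigr => x _; rewrite (morphD_sum tens_kronD); apply: eq_bigr => y _.
rewrite ascale_tensl tens_kronE; apply/matrixP=> x' y'.
rewrite !ascalemxE !mxE -(bij_eq kron_idx_bij x') -(bij_eq kron_idx_bij y').
move: (kron_idx x) (kron_idx y) (kron_idx x') (kron_idx y').
move=> [i k] [j l] [i' k'] [j' l'] /=; rewrite !xpair_eqE -mulrA -natrM mulnb.
by congr (_ * _%:R); rewrite andbACA.
Qed.

Lemma tens_kron_isom : ralg_isom tens_kron.
Proof.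
split.
- exact: tens_kronD.
- by rewrite [1 in LHS]/(tens 1%:M 1%:M) tens_kronE kron_scalar.
- apply: tensor_morphM; first exact: tens_kronD.
  by move=> a b a' b'; rewrite mul_tens !tens_kronE kronM.
- by move=> r; rewrite [in_ralg r in LHS]/(tens r%:M 1%:M) tens_kronE kron_scalar.
by exists unkron.
Qed.

Lemma mx_der_kron (D : derivation R) (Z : 'M[R]_m) (W : 'M[R]_n) a b :
  mx_der D (kron Z 1 + kron 1 W) (kron a b) =
  kron (mx_der D Z a) b + kron a (mx_der D W b).
Proof.
rewrite /= /mx_der_fun.
have -> : map_mx D (kron a b) = kron (map_mx D a) b + kron a (map_mx D b).
  by apply/matrixP=> x y; rewrite !mxE derM.
rewrite mulrDl mulrDr !kronM !mul1r !mulr1.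
rewrite !kronDl !kronDr kronNl kronNr.
exact: addr_regroup.
Qed.

End Kronecker.

Record comMonoid := ComMonoid {
  cm_sort :> Type;
  cm_mul : cm_sort -> cm_sort -> cm_sort;
  cm_one : cm_sort;
  cm_mulA : associative cm_mul;
  cm_mulC : commutative cm_mul;
  cm_mul1 : left_id cm_one cm_mul
}.

Record submonoid (M : comMonoid) := Submonoid {
  sub_mem :> M -> Prop;
  sub_one : sub_mem (cm_one M);
  sub_mul : forall x y, sub_mem x -> sub_mem y -> sub_mem (cm_mul x y)
}.

Record is_equiv (T : Type) (E : T -> T -> Prop) : Prop := IsEquiv {
  eqv_refl : forall x, E x x;
  eqv_sym : forall x y, E x y -> E y x;
  eqv_trans : forall x y z, E x y -> E y z -> E x z
}.

Definition eq_class (T : Type) (E : T -> T -> Prop) :=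
  {C : T -> Prop | exists x, C = E x}.

Definition class_of (T : Type) (E : T -> T -> Prop) (x : T) : eq_class E :=
  exist _ (E x) (ex_intro _ x erefl).

Definition class_repr (T : Type) (E : T -> T -> Prop) (C : eq_class E) : T :=
  sval (cid (svalP C)).

Section EqClass.
Variables (T : Type) (E : T -> T -> Prop).

Lemma eq_class_inj (C C' : eq_class E) : sval C = sval C' -> C = C'.
Proof.
case: C C' => [C hC] [C' hC'] /= CC'; move: hC'; rewrite -CC' => hC'.
by rewrite (Prop_irrelevance hC hC').
Qed.

Lemma class_ofP : is_equiv E ->
  forall x y, class_of E x = class_of E y <-> E x y.
Proof.
move=> eqE x y; split=> [/(congr1 sval) /= xy|xy].
  by rewrite xy; apply: (eqv_refl eqE).
suff Exy : E x = E y by apply: eq_class_inj.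
apply/funext => z; apply/propext; split; last exact: (eqv_trans eqE).
exact/(eqv_trans eqE)/(eqv_sym eqE).
Qed.

Lemma class_reprK (C : eq_class E) : class_of E (class_repr C) = C.
Proof. by apply: eq_class_inj; rewrite [RHS](svalP (cid (svalP C))). Qed.

Lemma class_ofW (P : eq_class E -> Prop) :
  (forall x, P (class_of E x)) -> forall C, P C.
Proof. by move=> h C; rewrite -(class_reprK C). Qed.

End EqClass.

(* The monoid of classes of a commutative monoid up to the equivalence E. *)
Section ClassMonoid.
Variables (T : Type) (E : T -> T -> Prop) (op : T -> T -> T) (one : T).
Hypothesis eqE : is_equiv E.
Hypothesis opE : forall x x' y y', E x x' -> E y y' -> E (op x y) (op x' y').
Hypothesis opA : forall x y z, E (op x (op y z)) (op (op x y) z).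
Hypothesis opC : forall x y, E (op x y) (op y x).
Hypothesis op1 : forall x, E (op one x) x.

Definition class_mul (C C' : eq_class E) : eq_class E :=
  class_of E (op (class_repr C) (class_repr C')).

Lemma class_mulE x y :
  class_mul (class_of E x) (class_of E y) = class_of E (op x y).
Proof.
by apply/(class_ofP eqE); apply: opE; apply/(class_ofP eqE); rewrite class_reprK.
Qed.

Lemma class_mulA : associative class_mul.
Proof.
elim/class_ofW=> x; elim/class_ofW=> y; elim/class_ofW=> z.
by rewrite !class_mulE; apply/(class_ofP eqE).
Qed.

Lemma class_mulC : commutative class_mul.
Proof.
elim/class_ofW=> x; elim/class_ofW=> y.
by rewrite !class_mulE; apply/(class_ofP eqE).
Qed.

Lemma class_mul1 : left_id (class_of E one) class_mul.
Proof. by elim/class_ofW=> x; rewrite class_mulE; apply/(class_ofP eqE). Qed.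

Definition class_monoid : comMonoid :=
  ComMonoid class_mulA class_mulC class_mul1.
End ClassMonoid.

Section MonoidQuotient.
Variables (M : comMonoid) (N : submonoid M).

Definition quo_rel (m1 m2 : M) : Prop :=
  exists n1 n2 : M, [/\ N n1, N n2 & cm_mul m1 n1 = cm_mul m2 n2].

Let mulACA (a b c d : M) :
  cm_mul (cm_mul a b) (cm_mul c d) = cm_mul (cm_mul a c) (cm_mul b d).
Proof.
by rewrite -!cm_mulA; congr cm_mul; rewrite !cm_mulA; congr cm_mul;
  apply: cm_mulC.
Qed.

Lemma quo_rel_equiv : is_equiv quo_rel.
Proof.
split=> [x|x y [n1 [n2 [h1 h2 e]]]|x y z [n1 [n2 [h1 h2 e]]] [n3 [n4 [h3 h4 e']]]].
- by exists (cm_one M), (cm_one M); split=> //; apply: sub_one.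
- by exists n2, n1.
exists (cm_mul n1 n3), (cm_mul n4 n2); split; [exact: sub_mul..|].
by rewrite !cm_mulA e -e' -!cm_mulA; congr cm_mul; apply: cm_mulC.
Qed.

Lemma quo_rel_mul x x' y y' :
  quo_rel x x' -> quo_rel y y' -> quo_rel (cm_mul x y) (cm_mul x' y').
Proof.
move=> [n1 [n2 [h1 h2 e]]] [n3 [n4 [h3 h4 e']]].
exists (cm_mul n1 n3), (cm_mul n2 n4); split; [exact: sub_mul..|].
by rewrite mulACA e e' mulACA.
Qed.

Let quo_rel_eq (x y : M) : x = y -> quo_rel x y.
Proof. by move->; apply: (eqv_refl quo_rel_equiv). Qed.

(* M / N *)
Definition monoid_quo : comMonoid := class_monoid quo_rel_equiv quo_rel_mul
  (fun x y z => quo_rel_eq (cm_mulA x y z))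
  (fun x y => quo_rel_eq (cm_mulC x y)) (fun x => quo_rel_eq (cm_mul1 x)).

Definition quo_class (m : M) : monoid_quo := class_of quo_rel m.

End MonoidQuotient.

(* The submonoid Q / P of M / P: the classes of the elements of Q. *)
Section SubQuotient.
Variables (M : comMonoid) (P Q : submonoid M).

Definition sub_quo_mem (x : monoid_quo P) : Prop :=
  exists2 q : M, Q q & x = quo_class P q.

Lemma sub_quo_one : sub_quo_mem (cm_one (monoid_quo P)).
Proof. by exists (cm_one M); first exact: sub_one. Qed.

Lemma sub_quo_mul x y :
  sub_quo_mem x -> sub_quo_mem y -> sub_quo_mem (cm_mul x y).
Proof.
move=> [q hq ->] [q' hq' ->]; exists (cm_mul q q'); first exact: sub_mul.
exact: (class_mulE (quo_rel_equiv P) (@quo_rel_mul _ P)).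
Qed.

Definition sub_quo : submonoid (monoid_quo P) :=
  Submonoid sub_quo_one sub_quo_mul.
End SubQuotient.

Section BrauerMonoid.
Variable R : comPzRingType.

Record azumaya := Azumaya {
  az_alg :> ralgType R;
  az_axiom : is_azumaya az_alg
}.

Definition az_iso (A B : azumaya) : Prop := exists f : A -> B, ralg_isom f.

Definition az_tensor (A B : azumaya) : azumaya :=
  Azumaya (tensor_azumaya (az_axiom A) (az_axiom B)).

Definition az_mx (n : nat) (n_gt0 : (0 < n)%N) : azumaya :=
  Azumaya (@mx_azumaya R n n_gt0).

Lemma az_iso_equiv : is_equiv az_iso.
Proof.
split=> [A|A B [f fi]|A B C [f fi] [g gi]].
- by exists id; apply: ralg_isom_id.
- by have [g [_ _ gi]] := ralg_isom_inv fi; exists g.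
- by exists (fun x => g (f x)); apply: ralg_isom_comp.
Qed.

Lemma az_iso_tensor A A' B B' :
  az_iso A A' -> az_iso B B' -> az_iso (az_tensor A B) (az_tensor A' B').
Proof.
by move=> [f fi] [g gi]; exists (tens_map f g); apply: tens_map_isom.
Qed.

Lemma az_tensorA A B C :
  az_iso (az_tensor A (az_tensor B C)) (az_tensor (az_tensor A B) C).
Proof.
by apply: (eqv_sym az_iso_equiv); exists (@tens_assoc R A B C);
   apply: tens_assoc_isom.
Qed.

Lemma az_tensorC A B : az_iso (az_tensor A B) (az_tensor B A).
Proof. by exists (@tens_swap R A B); apply: tens_swap_isom. Qed.

Lemma az_tensor1 A : az_iso (az_tensor (az_mx (ltn0Sn 0)) A) A.
Proof. by exists (@tens_unit R A); apply: tens_unit_isom. Qed.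

(* The unit is the class of M_1(R), which is isomorphic to R. *)
Definition MA : comMonoid :=
  class_monoid az_iso_equiv az_iso_tensor az_tensorA az_tensorC az_tensor1.

Definition MA_class (A : azumaya) : MA := class_of az_iso A.

Definition MM_mem (x : MA) : Prop :=
  exists (n : nat) (n_gt0 : (0 < n)%N), x = MA_class (az_mx n_gt0).

Lemma MM_one : MM_mem (cm_one MA).
Proof. by exists 1%N, (ltn0Sn 0). Qed.

Lemma MM_mul x y : MM_mem x -> MM_mem y -> MM_mem (cm_mul x y).
Proof.
move=> [m [m_gt0 ->]] [n [n_gt0 ->]].
have mn_gt0 : (0 < m * n)%N by rewrite muln_gt0 m_gt0.
exists (m * n)%N, mn_gt0.
rewrite [LHS](class_mulE az_iso_equiv az_iso_tensor).
apply/(class_ofP az_iso_equiv).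
by exists (@tens_kron R m n); apply: tens_kron_isom.
Qed.

Definition MM : submonoid MA := Submonoid MM_one MM_mul.

Definition BM : comMonoid := monoid_quo MM.

End BrauerMonoid.

Section DifferentialBrauerMonoid.
Variables (R : comPzRingType) (D : derivation R).

Record diffAzumaya := DiffAzumaya {
  da_az :> azumaya R;
  da_der : derivation da_az;
  da_ext : forall r : R, da_der (in_ralg r) = in_ralg (D r)
}.

Definition da_iso (A B : diffAzumaya) : Prop :=
  exists2 f : A -> B, ralg_isom f & forall x, f (da_der A x) = da_der B (f x).

Definition da_tensor (A B : diffAzumaya) : diffAzumaya :=
  @DiffAzumaya (az_tensor A B) (tens_der (@da_ext A) (@da_ext B))
    (tens_der_ext (@da_ext A) (@da_ext B)).

Lemma da_tensorE (A B : diffAzumaya) (a : A) (b : B) :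
  da_der (da_tensor A B) (tens a b) =
  tens (da_der A a) b + tens a (da_der B b).
Proof. exact: tens_derE. Qed.

(* (M_n(R), Z) *)
Definition da_mx (n : nat) (n_gt0 : (0 < n)%N) (Z : 'M[R]_n) : diffAzumaya :=
  @DiffAzumaya (az_mx R n_gt0) (mx_der D Z) (mx_der_ext D Z).

Lemma da_iso_equiv : is_equiv da_iso.
Proof.
split=> [A|A B [f fi fd]|A B C [f fi fd] [g gi gd]].
- by exists id => //; apply: ralg_isom_id.
- have [g [fK gK gi]] := ralg_isom_inv fi; exists g => // x.
  by apply: (can_inj fK); rewrite fd !gK.
- by exists (fun x => g (f x)) => [|x]; [apply: ralg_isom_comp|rewrite fd gd].
Qed.

Lemma da_iso_tensor A A' B B' :
  da_iso A A' -> da_iso B B' -> da_iso (da_tensor A B) (da_tensor A' B').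
Proof.
move=> [f fi fd] [g gi gd]; exists (tens_map f g); first exact: tens_map_isom.
elim/tensP=> [a b|x y IHx IHy]; last first.
  by rewrite !(derD, tens_mapD fi gi) IHx IHy.
rewrite da_tensorE (tens_mapD fi gi) !(tens_mapE fi gi).
by rewrite da_tensorE fd gd.
Qed.

Lemma da_tensorA A B C :
  da_iso (da_tensor A (da_tensor B C)) (da_tensor (da_tensor A B) C).
Proof.
apply: (eqv_sym da_iso_equiv); exists (@tens_assoc R A B C).
  exact: tens_assoc_isom.
elim/tensP3l=> [a b c|x y IHx IHy]; last by rewrite !(derD, tens_assocD) IHx IHy.
rewrite !da_tensorE tensDl !tens_assocD !tens_assocE.
by rewrite !da_tensorE tensDr addrA.
Qed.

Lemma da_tensorC A B : da_iso (da_tensor A B) (da_tensor B A).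
Proof.
exists (@tens_swap R A B); first exact: tens_swap_isom.
elim/tensP=> [a b|x y IHx IHy]; last by rewrite !(derD, tens_swapD) IHx IHy.
by rewrite da_tensorE tens_swapD !tens_swapE da_tensorE addrC.
Qed.

Lemma da_tensor1 A : da_iso (da_tensor (da_mx (ltn0Sn 0) 0) A) A.
Proof.
exists (@tens_unit R A); first exact: tens_unit_isom.
elim/tensP=> [m a|x y IHx IHy]; last by rewrite !(derD, tens_unitD) IHx IHy.
rewrite da_tensorE tens_unitD !tens_unitE /= /mx_der_fun.
by rewrite mul0r mulr0 subr0 addr0 mxE /ascale derM da_ext.
Qed.

(* The unit is the class of (M_1(R), 0), which is isomorphic to (R, D). *)
Definition MAdiff : comMonoid :=
  class_monoid da_iso_equiv da_iso_tensor da_tensorA da_tensorC da_tensor1.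

Definition MAdiff_class (A : diffAzumaya) : MAdiff := class_of da_iso A.

Definition MMdiff_mem (x : MAdiff) : Prop :=
  exists (n : nat) (n_gt0 : (0 < n)%N) (Z : 'M[R]_n),
    x = MAdiff_class (da_mx n_gt0 Z).

Definition MM0diff_mem (x : MAdiff) : Prop :=
  exists (n : nat) (n_gt0 : (0 < n)%N), x = MAdiff_class (da_mx n_gt0 0).

Lemma da_tensor_mx m n (m_gt0 : (0 < m)%N) (n_gt0 : (0 < n)%N)
    (mn_gt0 : (0 < m * n)%N) (Z : 'M[R]_m) (W : 'M[R]_n) :
  cm_mul (MAdiff_class (da_mx m_gt0 Z)) (MAdiff_class (da_mx n_gt0 W)) =
  MAdiff_class (da_mx mn_gt0 (kron Z 1 + kron 1 W)).
Proof.
rewrite [LHS](class_mulE da_iso_equiv da_iso_tensor).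
apply/(class_ofP da_iso_equiv).
exists (@tens_kron R m n); first exact: tens_kron_isom.
elim/tensP=> [a b|x y IHx IHy]; last by rewrite !(derD, tens_kronD) IHx IHy.
rewrite da_tensorE.
by rewrite tens_kronD !tens_kronE; symmetry; apply: mx_der_kron.
Qed.

Lemma MMdiff_one : MMdiff_mem (cm_one MAdiff).
Proof. by exists 1%N, (ltn0Sn 0), 0. Qed.

Lemma MMdiff_mul x y : MMdiff_mem x -> MMdiff_mem y -> MMdiff_mem (cm_mul x y).
Proof.
move=> [m [m_gt0 [Z ->]]] [n [n_gt0 [W ->]]].
have mn_gt0 : (0 < m * n)%N by rewrite muln_gt0 m_gt0.
exists (m * n)%N, mn_gt0, (kron Z 1 + kron 1 W).
exact: da_tensor_mx.
Qed.

Lemma MM0diff_one : MM0diff_mem (cm_one MAdiff).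
Proof. by exists 1%N, (ltn0Sn 0). Qed.

Lemma MM0diff_mul x y :
  MM0diff_mem x -> MM0diff_mem y -> MM0diff_mem (cm_mul x y).
Proof.
move=> [m [m_gt0 ->]] [n [n_gt0 ->]].
have mn_gt0 : (0 < m * n)%N by rewrite muln_gt0 m_gt0.
exists (m * n)%N, mn_gt0; rewrite (da_tensor_mx _ _ mn_gt0).
congr (MAdiff_class (da_mx _ _)); apply/matrixP=> x' y'.
by rewrite !mxE mul0r mulr0 addr0.
Qed.

Definition MMdiff : submonoid MAdiff := Submonoid MMdiff_one MMdiff_mul.

Definition MM0diff : submonoid MAdiff := Submonoid MM0diff_one MM0diff_mul.

Lemma MM0diff_sub x : MM0diff x -> MMdiff x.
Proof. by move=> [n [n_gt0 ->]]; exists n, n_gt0, 0. Qed.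

Definition BMdiff : comMonoid := monoid_quo MM0diff.

Definition MBMdiff : submonoid BMdiff := sub_quo MM0diff MMdiff.

End DifferentialBrauerMonoid.

(* Main.v *)
(** The hypothesis gives, for a differential Azumaya algebra A, an algebra
    isomorphism of A (x) M_m(R) with some M_n(R).  Transporting the derivation
    of A (x) (M_m(R), 0) gives a derivation of M_n(R) extending D; it differs
    from the entrywise derivation by an R-linear derivation, which is inner.
    Hence A (x) (M_m(R), 0) is (M_n(R), Z) for some matrix Z. *)
Require Import Defs.
From HB Require Import structures.
From mathcomp Require Import all_boot all_algebra.

Import GRing.Theory.
Local Open Scope ring_scope.

(** The separability idempotent [\sum_i e_io (x) e_oi] absorbs [Y] equally from the left and from
    the right. The map [a (x) b |-> d a * b], balanced as [d] is linear, sends it to [Z], so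
    [d Y + Y * Z = Z * Y]. *)
Lemma mx_linear_der_inner (R : comPzRingType) (n : nat) (d : 'M[R]_n -> 'M[R]_n) :
  (0 < n)%N -> {morph d : X Y / X + Y} ->
  (forall X Y, d (X * Y) = d X * Y + X * d Y) ->
  (forall r X, d (r *:: X) = r *:: d X) ->
  exists Z : 'M[R]_n, forall Y, d Y = Z * Y - Y * Z.
Proof.
move=> n_gt0 dD dM dZ; pose o := Ordinal n_gt0.
exists (\sum_i d (delta_mx i o) * delta_mx o i) => Y.
apply: (addIr (Y * \sum_i d (delta_mx i o) * delta_mx o i)); rewrite subrK.
(* Both sides equal [\sum_i d (Y e_io) e_oi]. *)
transitivity (\sum_i d (Y * delta_mx i o) * delta_mx o i).
  under [RHS]eq_bigr => i _ do rewrite dM mulrDl -!mulrA.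
  rewrite big_split /= -!mulr_sumr; congr (_ + _).
  rewrite -[LHS]mulr1; congr (_ * _); rewrite [LHS]mx1_sum_delta.
  by apply: eq_bigr => i _; rewrite -mulmxE mul_delta_mx.
rewrite mulr_suml.
have Ye i : Y * delta_mx i o = \sum_j Y j i *: delta_mx j o.
  apply/matrixP => k l; rewrite -mulmxE !mxE summxE (bigD1 i) //= big1 => [|j ji].
    rewrite (bigD1 k) //= big1 => [|j jk]; rewrite !mxE ?eqxx ?addr0 //.
    by rewrite eq_sym (negPf jk) mulr0.
  by rewrite mxE (negPf ji) mulr0.
have eY j : delta_mx o j * Y = \sum_i Y j i *: delta_mx o i.
  apply/matrixP => k l; rewrite -mulmxE !mxE summxE (bigD1 j) //= big1 => [|i ij].
    rewrite (bigD1 l) //= big1 => [|i il]; rewrite !mxE ?eqxx ?andbT ?addr0.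
      by rewrite mulrC.
    by rewrite [l == i]eq_sym (negPf il) andbF mulr0.
  by rewrite mxE (negPf ij) andbF mul0r.
(* Linearity of [d] lets the scalar [Y j i] pass from the left factor to the right one, where row
   [j] of [Y] reassembles. *)
under eq_bigr => i _.
  rewrite Ye (morphD_sum dD) mulr_suml.
  under eq_bigr => j _ do rewrite -ascalemxE dZ ascalemxE -mulmxE -scalemxAl scalemxAr.
  over.
rewrite exchange_big; apply: eq_bigr => j _.
by rewrite -mulrA eY mulr_sumr; apply: eq_bigr => i _; rewrite mulmxE.
Qed.

(** In the Leibniz rule for [r *:: X] the terms differentiating [r] cancel, so [E - E'] is
    [R]-linear. *)
Lemma mx_der_diff_inner (R : comPzRingType) (n : nat) (E E' : derivation 'M[R]_n) :
  (0 < n)%N -> (forall r : R, E (in_ralg r) = E' (in_ralg r)) ->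
  exists Z : 'M[R]_n, forall Y, E Y = E' Y + (Z * Y - Y * Z).
Proof.
move=> n_gt0 EE'.
have [X Y|X Y|r X|Z dE] := @mx_linear_der_inner R n (fun Y => E Y - E' Y) n_gt0.
- by rewrite !derD opprD addrACA.
- by rewrite !derM mulrBl mulrBr opprD addrACA.
- by rewrite /ascale !derM EE' opprD addrACA subrr add0r mulrBr.
by exists Z => Y; rewrite -dE addrC subrK.
Qed.

Lemma mx_der_inner (R : comPzRingType) (D : derivation R) (n : nat)
    (E : derivation 'M[R]_n) :
  (0 < n)%N -> (forall r, E (in_ralg r) = in_ralg (D r)) ->
  exists Z : 'M[R]_n, forall Y, E Y = mx_der D Z Y.
Proof.
move=> n_gt0 Eext.
(* [mx_der D 0] is the entrywise derivative. *)
have [r|Z EZ] := @mx_der_diff_inner R n E (mx_der D 0) n_gt0.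
  by rewrite Eext mx_der_ext.
exists Z => Y; rewrite EZ /= /mx_der_fun.
by rewrite mul0r mulr0 addr0 subr0 addrA.
Qed.

Lemma da_mx_isom (R : comPzRingType) (D : derivation R) (A : diffAzumaya D)
    (n : nat) (n_gt0 : (0 < n)%N) :
  az_iso A (az_mx R n_gt0) -> exists Z : 'M[R]_n, da_iso A (da_mx D n_gt0 Z).
Proof.
move=> [f fi]; have [g [fK gK [gD _ gM gr _]]] := ralg_isom_inv fi.
have [fD _ fM fr _] := fi.
have ED : {morph (fun Y => f (da_der A (g Y))) : X Y / X + Y}.
  by move=> X Y; rewrite gD derD fD.
have EM X Y : f (da_der A (g (X * Y))) =
    f (da_der A (g X)) * Y + X * f (da_der A (g Y)).
  by rewrite gM derM fD !fM !gK.
(* The conjugate of [da_der A] by [f] still extends [D], since [f] and [g] fix scalars. *)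
have [r|Z EZ] := @mx_der_inner R D n (Derivation ED EM) n_gt0.
  by rewrite /= gr da_ext fr.
by exists Z, f => // x; rewrite -[RHS]EZ /= fK.
Qed.

Theorem corollary7 (R : comPzRingType) (D : derivation R) :
  (forall x : BM R, x = cm_one (BM R)) ->
  forall x : BMdiff D, MBMdiff D x.
Proof.
move=> BM1; elim/class_ofW; elim/class_ofW => A.
have /(class_ofP (quo_rel_equiv _)) := BM1 (quo_class (MM R) (MA_class A)).
move=> [_ [_ [[m [m_gt0 ->]] [n [n_gt0 ->]] ]]].
(* The relation to the trivial class reads [[A] [M_m(R)] = 1 [M_n(R)]]. *)
rewrite [LHS](class_mulE (@az_iso_equiv R) (@az_iso_tensor R)) cm_mul1.
move=> /(class_ofP (@az_iso_equiv R)) AmB.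
have [Z AZ] := @da_mx_isom R D (da_tensor A (da_mx D m_gt0 0)) n n_gt0 AmB.
exists (MAdiff_class (da_mx D n_gt0 Z)); first by exists n, n_gt0, Z.
apply/(class_ofP (quo_rel_equiv _)).
(* The equality to check is [[A] [(M_m(R), 0)] = [(M_n(R), Z)] 1]. *)
exists (MAdiff_class (da_mx D m_gt0 0)), (cm_one (MAdiff D)).
split; [by exists m, m_gt0 | exact: MM0diff_one |].
rewrite [LHS](class_mulE (@da_iso_equiv R D) (@da_iso_tensor R D)).
by rewrite cm_mulC cm_mul1; apply/(class_ofP (@da_iso_equiv R D)).
Qed.
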